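(* The following identities hold: $$\text{(S1)}\quad \sum_{k=0}^\infty\frac{(6k^2-19k+6)k^3\binom{2k}{k}^3}{256^k}=-\frac{1}{12\pi},$$ $$\text{(S1}'\text{)}\quad \sum_{k=0}^\infty\frac{(13608k^2+25050k+10589)\binom{2k}{k+1}^3}{256^k}=27296-\frac{84604}{\pi},$$ $$\text{(S2)}\quad \sum_{k=0}^\infty\frac{(18k^2-29k+16)k^3\binom{2k}{k}^3}{(-512)^k}=\frac{\sqrt2}{24\pi},$$ $$\text{(S2}'\text{)}\quad \sum_{k=0}^\infty\frac{(83592k^2+152922k+64925)\binom{2k}{k+1}^3}{(-512)^k}=625282\frac{\sqrt2}{\pi}-281920,$$ $$\text{(S3)}\quad \sum_{k=0}^\infty\frac{(198k^2-425k+210)k^3\binom{2k}{k}^3}{4096^k}=-\frac{1}{21\pi},$$ $$\text{(S3}'\text{)}\quad \sum_{k=0}^\infty\frac{(32473224k^2+58012446k+24235261)\binom{2k}{k+1}^3}{4096^k}=667628032-\frac{2097324016}{\pi}.$$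
   Context: Binomial coefficients $\binom{n}{j}$ are the usual ones, with $\binom{n}{j}=0$ for $j>n\ge 0$; in particular $\binom{0}{1}=0$. *)

(* Defs.v *)
From Stdlib Require Import Reals.
From mathcomp Require binomial.

Open Scope R_scope.

(* Stdlib's [Binomial.C] is not usable here: by truncated subtraction it gives
   [C 0 1 = 1].  MathComp's [binomial n j] is 0 whenever [n < j]. *)
Definition binom (n j : nat) : R := INR (binomial.binomial n j).

(* Main.v *)
Require Import Defs.
From Stdlib Require Import Reals Factorial Lra Lia.
From Coquelicot Require Import Coquelicot.
From mathcomp Require binomial.

Open Scope R_scope.

(** Telescoping, [term k = alpha * g k + (T (k+1) - T k)], reduces each pair of
    series to one of Ramanujan's
      sum (6k+1) w_k^3 / 4^k = 4/pi,  sum (6k+1) w_k^3 / (-8)^k = 2 sqrt 2/pi,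
      sum (42k+5) w_k^3 / 64^k = 16/pi,   w_k = binom(2k,k) / 4^k.
    Each of these is the case k = 0 of a sum over n of G(n,k), where (F,G) is a
    Wilf-Zeilberger pair, F(n+1,k) - F(n,k) = G(n,k+1) - G(n,k), so the sum does
    not depend on k.  As k tends to infinity only the term n = 0 survives, and
    its limit is given by Wallis' product. *)

(** Convergence at the explicit rate 1/(k+1), the form in which the error in Wallis' product and the
    tail of a Wilf-Zeilberger sum are estimated. *)
Lemma is_lim_seq_le_const_mul_inv (u : nat -> R) (c : R) :
  (forall k, Rabs (u k) <= c / (INR k + 1)) -> is_lim_seq u 0.
Proof.
intros Hu.
assert (Hv : is_lim_seq (fun k => c / (INR k + 1)) 0).
{ apply is_lim_seq_ext with (fun k => c * / INR (S k)).
  { intros k. now rewrite S_INR. }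
  replace (Finite 0) with (Rbar_mult c 0) by (simpl; f_equal; ring).
  apply is_lim_seq_scal_l.
  apply (is_lim_seq_incr_1 (fun k => / INR k)).
  replace (Finite 0) with (Rbar_inv p_infty) by reflexivity.
  apply is_lim_seq_inv; [apply is_lim_seq_INR | discriminate]. }
apply is_lim_seq_abs_0.
apply is_lim_seq_le_le with (fun _ => 0) (fun k => c / (INR k + 1)).
- intros k. split; [apply Rabs_pos | apply Hu].
- apply is_lim_seq_const.
- exact Hv.
Qed.

(** * Wallis integrals and Wallis' product *)

Definition sin_int (n : nat) : R := RInt (fun x => sin x ^ n) 0 (PI / 2).

Lemma continuous_sin_pow (n : nat) (x : R) : continuous (fun y => sin y ^ n) x.
Proof.
apply (ex_derive_continuous (fun y => sin y ^ n)). auto_derive. exact I.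
Qed.

Lemma ex_RInt_sin_pow (n : nat) : ex_RInt (fun x => sin x ^ n) 0 (PI / 2).
Proof. apply (ex_RInt_continuous (V := R_CompleteNormedModule)).
intros x _. apply continuous_sin_pow. Qed.

(* Integrate the derivative of [- cos x * sin x ^ (n + 1)]. *)
Lemma sin_int_rec (n : nat) : (INR n + 2) * sin_int (S (S n)) = (INR n + 1) * sin_int n.
Proof.
assert (Hd : is_RInt (fun x => (INR n + 2) * sin x ^ S (S n) - (INR n + 1) * sin x ^ n)
               0 (PI / 2)
               (minus (- cos (PI / 2) * sin (PI / 2) ^ S n) (- cos 0 * sin 0 ^ S n))).
{ apply (is_RInt_derive (fun x => - cos x * sin x ^ S n)).
  - intros x _. auto_derive; [exact I|].
    change (match n with O => 1 | S _ => INR n + 1 end) with (INR (S n)). rewrite S_INR.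
    assert (Hc : cos x * cos x = 1 - sin x * sin x).
    { generalize (sin2_cos2 x). unfold Rsqr. lra. }
    simpl.
    transitivity (sin x * (sin x * sin x ^ n) - (INR n + 1) * (cos x * cos x) * sin x ^ n).
    + ring.
    + rewrite Hc. ring.
  - intros x _. apply (ex_derive_continuous (V := R_NormedModule)). auto_derive. exact I. }
assert (He : is_RInt (fun x => (INR n + 2) * sin x ^ S (S n) - (INR n + 1) * sin x ^ n)
               0 (PI / 2)
               (minus (scal (INR n + 2) (sin_int (S (S n)))) (scal (INR n + 1) (sin_int n)))).
{ apply (is_RInt_minus (V := R_NormedModule)).
  - apply (is_RInt_scal (V := R_NormedModule)).
    apply (RInt_correct (V := R_CompleteNormedModule)). apply ex_RInt_sin_pow.
  - apply (is_RInt_scal (V := R_NormedModule)).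
    apply (RInt_correct (V := R_CompleteNormedModule)). apply ex_RInt_sin_pow. }
apply (is_RInt_unique (V := R_CompleteNormedModule)) in Hd, He.
rewrite Hd in He. clear Hd.
(* Both boundary terms vanish: the upper one through cos (PI/2) = 0, the lower one through the
   positive power of sin 0 = 0. *)
rewrite cos_PI2, sin_0 in He.
unfold minus, plus, opp, scal in He; simpl in He; unfold mult in He; simpl in He.
unfold sin_int at 1. simpl. unfold sin_int in He. simpl in He. unfold sin_int.
lra.
Qed.

Lemma sin_int_decr (n : nat) : sin_int (S n) <= sin_int n.
Proof.
apply RInt_le; try apply ex_RInt_sin_pow.
- generalize PI_RGT_0; lra.
- intros x Hx. simpl.
  assert (0 <= sin x) by (apply sin_ge_0; generalize PI_RGT_0; lra).
  generalize (SIN_bound x) (pow_le (sin x) n H); nra.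
Qed.

Lemma sin_int_0 : sin_int 0 = PI / 2.
Proof.
unfold sin_int. simpl. rewrite RInt_const. unfold scal; simpl; unfold mult; simpl. lra.
Qed.

Lemma sin_int_1 : sin_int 1 = 1.
Proof.
apply (is_RInt_unique (V := R_CompleteNormedModule)).
replace 1 with (minus (- cos (PI / 2)) (- cos 0)).
- apply (is_RInt_derive (fun x => - cos x)).
  + intros x _. auto_derive; [exact I | ring].
  + intros x _. apply continuous_sin_pow.
- rewrite cos_PI2, cos_0. unfold minus, plus, opp; simpl. ring.
Qed.

Fixpoint rising (a : R) (n : nat) : R :=
  match n with
  | O => 1
  | S m => rising a m * (a + INR m)
  end.

Lemma rising_pos (a : R) (n : nat) : 0 < a -> 0 < rising a n.
Proof.
intros Ha. induction n as [|n IH]; simpl; [lra|].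
apply Rmult_lt_0_compat; [exact IH | generalize (pos_INR n); lra].
Qed.

(** The Pochhammer quotient is the form in which these numbers occur inside the Wilf-Zeilberger
    pairs; [binom_central] returns to binomial coefficients. *)
Definition w (n : nat) : R := rising (1 / 2) n / INR (fact n).

Lemma w_pos (n : nat) : 0 < w n.
Proof.
apply Rdiv_lt_0_compat; [apply rising_pos; lra | apply lt_0_INR, lt_O_fact].
Qed.

Lemma w_S (n : nat) : w (S n) = w n * (2 * INR n + 1) / (2 * (INR n + 1)).
Proof.
unfold w. rewrite fact_simpl, mult_INR, S_INR. simpl rising.
generalize (INR_fact_neq_0 n) (pos_INR n). intros. field. split; lra.
Qed.

(** By [sin_int_rec] and [w_S], both sides gain the factor (2k+1)/(2k+2) from k to k+1. *)
Lemma sin_int_even (k : nat) : sin_int (2 * k) = PI / 2 * w k.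
Proof.
induction k as [|k IH].
- change (2 * 0)%nat with 0%nat. rewrite sin_int_0. unfold w; simpl. field.
- replace (2 * S k)%nat with (S (S (2 * k))) by lia.
  generalize (sin_int_rec (2 * k)). rewrite IH, w_S, mult_INR. simpl (INR 2).
  generalize (pos_INR k). intros Hk H.
  apply Rmult_eq_reg_l with (2 * INR k + 2); [|lra].
  replace (2 * INR k + 2) with ((1 + 1) * INR k + 2) at 1 by ring.
  rewrite H. field. lra.
Qed.

(** From k to k+1 the integral gains the factor (2k+2)/(2k+3), and (2k+1) w_k gains its inverse. *)
Lemma sin_int_odd (k : nat) : sin_int (2 * k + 1) * ((2 * INR k + 1) * w k) = 1.
Proof.
induction k as [|k IH].
- change (2 * 0 + 1)%nat with 1%nat. rewrite sin_int_1. unfold w; simpl. field.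
- replace (2 * S k + 1)%nat with (S (S (2 * k + 1))) by lia.
  generalize (sin_int_rec (2 * k + 1)). rewrite w_S, plus_INR, mult_INR.
  simpl (INR 2). simpl (INR 1).
  generalize (pos_INR k). intros Hk H.
  etransitivity; [|exact IH].
  replace (sin_int (S (S (2 * k + 1)))) with
    ((2 * INR k + 2) * sin_int (2 * k + 1) / (2 * INR k + 3)).
  + rewrite S_INR. field. lra.
  + apply Rmult_eq_reg_l with ((1 + 1) * INR k + 1 + 2); [|lra].
    rewrite H. field. lra.
Qed.

(** The integrals decrease. Comparing index 2k+1 with 2k gives the lower bound, and comparing 2k+2
    with 2k+1 gives the upper one. *)
Lemma wallis_bounds (k : nat) :
  2 / PI <= (2 * INR k + 1) * w k ^ 2 <= 2 / PI * (1 + 1 / (INR k + 1)).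
Proof.
generalize (pos_INR k) (w_pos k) (sin_int_odd k) PI_RGT_0; intros Hk Hw Ho HP.
assert (H1 := sin_int_decr (2 * k)).
replace (S (2 * k)) with (2 * k + 1)%nat in H1 by lia.
assert (H2 := sin_int_decr (2 * k + 1)).
replace (S (2 * k + 1)) with (2 * S k)%nat in H2 by lia.
rewrite sin_int_even in H1, H2. rewrite w_S in H2.
assert (Hp : 0 < (2 * INR k + 1) * w k) by nra.
split.
- apply Rmult_le_reg_l with (PI / 2); [lra|].
  replace (PI / 2 * (2 / PI)) with 1 by (field; lra).
  apply Rle_trans with (sin_int (2 * k + 1) * ((2 * INR k + 1) * w k)); [lra|].
  replace (PI / 2 * ((2 * INR k + 1) * w k ^ 2)) with (PI / 2 * w k * ((2 * INR k + 1) * w k))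
    by ring.
  apply Rmult_le_compat_r; lra.
- assert (H3 : PI / 2 * (w k * (2 * INR k + 1) / (2 * (INR k + 1))) * ((2 * INR k + 1) * w k)
       <= 1).
  { apply Rle_trans with (1 := Rmult_le_compat_r _ _ _ (Rlt_le _ _ Hp) H2). lra. }
  apply Rmult_le_reg_l with (PI / 2 * (2 * INR k + 1) / (2 * (INR k + 1))).
  { apply Rdiv_lt_0_compat; nra. }
  eapply Rle_trans; [eapply Rle_trans; [right | exact H3]|].
  + field. lra.
  + replace (PI / 2 * (2 * INR k + 1) / (2 * (INR k + 1)) * (2 / PI * (1 + 1 / (INR k + 1))))
      with (1 + INR k * / (2 * (INR k + 1) ^ 2)) by (field; lra).
    assert (0 <= INR k * / (2 * (INR k + 1) ^ 2)); [|lra].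
    apply Rmult_le_pos; [lra|]. left. apply Rinv_0_lt_compat. nra.
Qed.

(** The factor 4k+1, rather than 2k+1, is the one that the Wilf-Zeilberger pairs produce at n =
    0. *)
Lemma wallis : is_lim_seq (fun k => (4 * INR k + 1) * w k ^ 2) (4 / PI).
Proof.
assert (Hl : is_lim_seq (fun k => (4 * INR k + 1) * w k ^ 2 - 4 / PI) 0).
{ apply is_lim_seq_le_const_mul_inv with (8 / PI). intros k.
  generalize (wallis_bounds k) (pos_INR k). intros Hb Hk.
  set (q := 2 / PI) in Hb.
  assert (Hq : 0 < q) by (apply Rdiv_lt_0_compat; [lra | apply PI_RGT_0]).
  replace (4 / PI) with (2 * q) by (unfold q; field; apply PI_neq0).
  replace (8 / PI) with (4 * q) by (unfold q; field; apply PI_neq0).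
  set (u := (2 * INR k + 1) * w k ^ 2) in Hb.
  replace ((4 * INR k + 1) * w k ^ 2) with (2 * u - u * / (2 * INR k + 1))
    by (unfold u; field; lra).
  set (v := / (INR k + 1)).
  replace (4 * q / (INR k + 1)) with (4 * q * v) by reflexivity.
  replace (1 / (INR k + 1)) with v in Hb by (unfold v, Rdiv; ring).
  assert (Hv : 0 < v <= 1).
  { unfold v; split; [apply Rinv_0_lt_compat; lra|].
    rewrite <- Rinv_1. apply Rinv_le_contravar; lra. }
  assert (Hr : 0 < / (2 * INR k + 1) <= v).
  { unfold v; split; [apply Rinv_0_lt_compat; lra|]. apply Rinv_le_contravar; lra. }
  set (r := / (2 * INR k + 1)) in *.
  (* Here u <= q (1 + v) <= 2q and r <= v. Both 2u - 2q and u r thus lie between 0 and 2qv, which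
     bounds their difference. *)
  assert (Hur : 0 <= u * r <= 2 * q * v).
  { split; [apply Rmult_le_pos; nra|].
    apply Rmult_le_compat; nra. }
  apply Rabs_le. nra. }
apply is_lim_seq_ext with (fun k => ((4 * INR k + 1) * w k ^ 2 - 4 / PI) + 4 / PI).
{ intros k. ring. }
replace (Finite (4 / PI)) with (Finite (0 + 4 / PI)) by (f_equal; ring).
apply is_lim_seq_plus'; [exact Hl | apply is_lim_seq_const].
Qed.

(** * Summation by Wilf-Zeilberger pairs *)

(** Domination by a geometric series. The bound on the sum is what later controls all terms n >= 1
    of a sum by the term n = 1. *)
Lemma ex_series_half_ratio (a : nat -> R) :
  (forall n, Rabs (a (S n)) <= / 2 * Rabs (a n)) ->
  ex_series a /\ Rabs (Series a) <= 2 * Rabs (a 0%nat).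
Proof.
intros Ha.
assert (Hg : forall n, Rabs (a n) <= (/ 2) ^ n * Rabs (a 0%nat)).
{ induction n as [|n IH]; simpl; [lra|].
  specialize (Ha n). lra. }
assert (Hh : Rabs (/ 2) < 1) by (rewrite Rabs_pos_eq; lra).
assert (Hs : is_series (fun n => (/ 2) ^ n * Rabs (a 0%nat)) (2 * Rabs (a 0%nat))).
{ replace (2 * Rabs (a 0%nat)) with (/ (1 - / 2) * Rabs (a 0%nat)) by field.
  apply is_series_scal_r. now apply is_series_geom. }
assert (Hx : ex_series (fun n => Rabs (a n))).
{ apply (ex_series_le (K := R_AbsRing) (V := R_CompleteNormedModule)) with (2 := ex_intro _ _ Hs).
  intros n. unfold norm; simpl; unfold abs; simpl. now rewrite Rabs_Rabsolu. }
split; [now apply ex_series_Rabs|].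
eapply Rle_trans; [now apply Series_Rabs|].
rewrite <- (is_series_unique _ _ Hs).
apply Series_le; [|eexists; exact Hs].
intros n. split; [apply Rabs_pos | apply Hg].
Qed.

(** The ratio bound 1/2 starts only at n = 1: the passage from n = 0 to n = 1 has to gain a factor
    of order 1/(k+1), so that the terms n >= 1 disappear as k grows. *)
Lemma wz_series (F G : nat -> nat -> R) (c d L : R) :
  (forall k, F 0%nat k = 0) ->
  (forall n k, F (S n) k - F n k = G n (S k) - G n k) ->
  (forall n k, Rabs (F n k) <= c * Rabs (G n k)) ->
  (forall n k, Rabs (G (S (S n)) k) <= / 2 * Rabs (G (S n) k)) ->
  (forall k, Rabs (G 1%nat k) <= d / (INR k + 1) * Rabs (G 0%nat k)) ->
  is_lim_seq (fun k => G 0%nat k) L ->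
  is_series (fun n => G n 0%nat) L.
Proof.
intros HF0 Hwz HFG Hgeom H1 HL.
assert (Htail : forall k, ex_series (fun n => G (S n) k) /\
          Rabs (Series (fun n => G (S n) k)) <= 2 * Rabs (G 1%nat k)).
{ intros k. apply (ex_series_half_ratio (fun n => G (S n) k)). intros n. apply Hgeom. }
assert (Hex : forall k, ex_series (fun n => G n k)).
{ intros k. apply ex_series_incr_1. apply Htail. }
assert (Hstep : forall k, Series (fun n => G n (S k)) = Series (fun n => G n k)).
{ intros k. apply Rminus_diag_uniq.
  rewrite <- Series_minus by apply Hex.
  apply is_series_unique.
  (* [F (S N) k] is the partial sum of the differences of G, as [F 0 k] = 0. It tends to 0 because F
     is dominated by G, whose terms are summable in n. *)
  assert (Hlim : is_lim_seq (fun N => F (S N) k) 0).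
  { apply (is_lim_seq_incr_1 (fun N => F N k)).
    apply is_lim_seq_abs_0.
    apply is_lim_seq_le_le with (fun _ => 0) (fun N => c * Rabs (G N k)).
    - intros N. split; [apply Rabs_pos | apply HFG].
    - apply is_lim_seq_const.
    - replace (Finite 0) with (Rbar_mult c 0) by (simpl; f_equal; ring).
      apply is_lim_seq_scal_l.
      apply (is_lim_seq_abs_0 (fun N => G N k)).
      apply ex_series_lim_0, Hex. }
  apply (is_lim_seq_ext _ (sum_n (fun n => G n (S k) - G n k))) with (2 := Hlim).
  induction n as [|n IH].
  - rewrite sum_O, <- Hwz, HF0. ring.
  - rewrite sum_Sn, <- IH, <- Hwz. unfold plus; simpl. ring. }
assert (Hconst : forall k, Series (fun n => G n k) = Series (fun n => G n 0%nat)).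
{ induction k as [|k IH]; [reflexivity | now rewrite Hstep]. }
replace L with (Series (fun n => G n 0%nat)); [apply Series_correct, Hex|].
assert (Hdiff : is_lim_seq (fun k => Series (fun n => G (S n) k)) 0).
(* A convergent sequence is bounded, so the tail is at most 2 |d| M / (k+1). *)
{ destruct (filterlim_bounded (fun k => G 0%nat k)) as [M HM].
  { exists L. exact HL. }
  apply is_lim_seq_le_const_mul_inv with (2 * (Rabs d * M)).
  intros k. eapply Rle_trans; [apply Htail|].
  specialize (H1 k). specialize (HM k). change (Rabs (G 0%nat k) <= M) in HM.
  generalize (pos_INR k); intros Hk.
  assert (Hi : 0 < / (INR k + 1)) by (apply Rinv_0_lt_compat; lra).
  unfold Rdiv in *.
  assert (Hd : d * / (INR k + 1) <= Rabs d * / (INR k + 1)).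
  { apply Rmult_le_compat_r; [lra | apply Rle_abs]. }
  assert (H0 := Rabs_pos (G 0%nat k)). assert (Hp := Rabs_pos d).
  assert (d * / (INR k + 1) * Rabs (G 0%nat k) <= Rabs d * / (INR k + 1) * M).
  { apply Rle_trans with (Rabs d * / (INR k + 1) * Rabs (G 0%nat k)).
    - now apply Rmult_le_compat_r.
    - apply Rmult_le_compat_l; [nra | exact HM]. }
  lra. }
(* The sum, constant in k, is split into its term n = 0 and the vanishing tail; uniqueness of limits
   then identifies it with L. *)
assert (Hlim : is_lim_seq (fun _ : nat => Series (fun n => G n 0%nat)) (L + 0)).
{ apply is_lim_seq_ext with (fun k => G 0%nat k + Series (fun n => G (S n) k)).
  - intros k. rewrite <- (Hconst k). symmetry. apply Series_incr_1, Hex.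
  - apply is_lim_seq_plus'; assumption. }
apply is_lim_seq_unique in Hlim. rewrite Lim_seq_const in Hlim.
injection Hlim. lra.
Qed.

Lemma rising_S (a : R) (n : nat) : rising a (S n) = rising a n * (a + INR n).
Proof. reflexivity. Qed.

Lemma INR_fact_S (n : nat) : INR (fact (S n)) = (INR n + 1) * INR (fact n).
Proof. now rewrite fact_simpl, mult_INR, S_INR. Qed.

Lemma w_rising (n : nat) : rising (1 / 2) n = w n * INR (fact n).
Proof. unfold w. field. apply INR_fact_neq_0. Qed.

(* The Wilf-Zeilberger pair is F = Q H, G = P H. *)
Lemma wz_series_hypergeometric (H : nat -> nat -> R) (P Q r s : R -> R -> R) (c d L : R) :
  (forall n k, H (S n) k = r (INR n) (INR k) * H n k) ->
  (forall n k, H n (S k) = s (INR n) (INR k) * H n k) ->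
  (forall y, Q 0 y = 0) ->
  (forall x y, 0 <= x -> 0 <= y ->
     Q (x + 1) y * r x y - Q x y = P x (y + 1) * s x y - P x y) ->
  (forall x y, 0 <= x -> 0 <= y -> 0 <= P x y /\ Rabs (Q x y) <= c * P x y) ->
  (forall x y, 1 <= x -> 0 <= y -> Rabs (P (x + 1) y * r x y) <= / 2 * P x y) ->
  (forall y, 0 <= y -> Rabs (P 1 y * r 0 y) <= d / (y + 1) * P 0 y) ->
  is_lim_seq (fun k => P 0 (INR k) * H 0%nat k) L ->
  is_series (fun n => P (INR n) 0 * H n 0%nat) L.
Proof.
intros Hr Hs HQ0 Hid HP Hgeom H1 HL.
assert (Habs : forall p q h, 0 <= q -> Rabs p <= q -> Rabs (p * h) <= Rabs (q * h)).
{ intros p q h Hq Hpq. rewrite !Rabs_mult, (Rabs_pos_eq q) by exact Hq.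
  apply Rmult_le_compat_r; [apply Rabs_pos | exact Hpq]. }
apply (wz_series (fun n k => Q (INR n) (INR k) * H n k) (fun n k => P (INR n) (INR k) * H n k)
         (Rabs c) d L).
- intros k. simpl (INR 0). rewrite HQ0. ring.
(* Both shifts of H are multiples of [H n k], so the relation is the rational identity [Hid] times
   [H n k]. *)
- intros n k. rewrite Hr, Hs, !S_INR.
  generalize (Hid _ _ (pos_INR n) (pos_INR k)); intros E.
  transitivity ((Q (INR n + 1) (INR k) * r (INR n) (INR k) - Q (INR n) (INR k)) * H n k); [ring|].
  rewrite E. ring.
- intros n k. destruct (HP _ _ (pos_INR n) (pos_INR k)) as [Hp Hx].
  rewrite !Rabs_mult, (Rabs_pos_eq (P _ _)), <- Rmult_assoc by exact Hp.
  apply Rmult_le_compat_r; [apply Rabs_pos|].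
  apply Rle_trans with (1 := Hx).
  apply Rmult_le_compat_r; [exact Hp | apply Rle_abs].
- intros n k. rewrite Hr.
  set (x := INR (S n)). rewrite (S_INR (S n)). fold x.
  assert (Hx : 1 <= x) by (unfold x; rewrite S_INR; generalize (pos_INR n); lra).
  assert (Hk := pos_INR k).
  destruct (HP x (INR k)) as [Hp _]; [lra | exact Hk|].
  rewrite <- Rmult_assoc.
  eapply Rle_trans; [apply Habs; [|apply Hgeom; assumption]; lra|].
  rewrite Rmult_assoc, Rabs_mult, (Rabs_pos_eq (/ 2)) by lra. lra.
- intros k. rewrite Hr. simpl (INR 1). simpl (INR 0).
  assert (Hk := pos_INR k).
  destruct (HP 0 (INR k)) as [Hp _]; [lra | exact Hk|].
  assert (Hd : 0 <= d / (INR k + 1) * P 0 (INR k)).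
  { eapply Rle_trans; [apply Rabs_pos | apply H1, Hk]. }
  rewrite <- Rmult_assoc.
  eapply Rle_trans; [apply Habs; [exact Hd|]; apply H1, Hk|].
  rewrite Rmult_assoc, !Rabs_mult.
  (* The sign of d is not prescribed. If d is negative, [Hd] and P >= 0 force P(0,k) = 0, and both
     sides vanish. *)
  destruct (Rle_lt_dec 0 (d / (INR k + 1))) as [Hd'|Hd'].
  + rewrite Rabs_pos_eq by exact Hd'. lra.
  + assert (P 0 (INR k) = 0) by nra. rewrite H0, Rabs_R0. lra.
- exact HL.
Qed.

(** * The three Ramanujan series *)

Lemma is_series_ext_R (a b : nat -> R) (l : R) :
  (forall n, a n = b n) -> is_series a l -> is_series b l.
Proof. exact (is_series_ext a b l). Qed.

Lemma Rdiv_le_of_le_mul (a b c : R) : 0 < b -> a <= c * b -> a / b <= c.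
Proof. intros Hb H. now apply Rle_div_l. Qed.

Ltac fact_pos n := let H := fresh in assert (H := lt_0_INR _ (lt_O_fact n)).

(** At k = 0 the pair below gives this series; at n = 0 it gives (4k+1) w_k^2, whose limit is
    [wallis]. *)
Lemma ramanujan_256 :
  is_series (fun n => (6 * INR n + 1) * w n ^ 3 * (1 / 4) ^ n) (4 / PI).
Proof.
apply (is_series_ext_R (fun n => (6 * INR n + 4 * 0 + 1) *
  ((1 / 4) ^ n * rising (1 / 2) n ^ 3 * rising (1 / 2) 0 ^ 2 /
    (INR (fact n) * INR (fact (n + 0)) ^ 2)))).
{ intros n. rewrite Nat.add_0_r. unfold w. simpl rising. field. apply INR_fact_neq_0. }
(* The arguments are H, P, Q, the quotients r = H(n+1,k)/H(n,k) and s = H(n,k+1)/H(n,k), then the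
   constants c and d. *)
apply (wz_series_hypergeometric (fun n k => (1 / 4) ^ n * rising (1 / 2) n ^ 3 *
    rising (1 / 2) k ^ 2 / (INR (fact n) * INR (fact (n + k)) ^ 2))
  (fun x y => 6 * x + 4 * y + 1) (fun x y => 8 * x)
  (fun x y => 1 / 4 * (x + 1 / 2) ^ 3 / ((x + 1) * (x + y + 1) ^ 2))
  (fun x y => (y + 1 / 2) ^ 2 / (x + y + 1) ^ 2) 2 1).
- intros n k. simpl (S n + k)%nat. rewrite !INR_fact_S, rising_S, plus_INR.
  fact_pos n; fact_pos (n + k)%nat. generalize (pos_INR n) (pos_INR k); intros.
  simpl pow. field. lra.
- intros n k. rewrite Nat.add_succ_r, !INR_fact_S, rising_S, plus_INR.
  fact_pos n; fact_pos (n + k)%nat. generalize (pos_INR n) (pos_INR k); intros.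
  field. lra.
- intros y. ring.
- intros x y Hx Hy. field. lra.
- intros x y Hx Hy. rewrite Rabs_pos_eq; lra.
- intros x y Hx Hy.
  rewrite Rabs_pos_eq.
  2: { apply Rmult_le_pos; [lra|]. apply Rdiv_le_0_compat; [|nra].
       apply Rmult_le_pos; [lra|]. apply pow_le; lra. }
  (* With r <= 1/4 it remains that P(x+1,y) <= 2 P(x,y), which holds since x >= 1. *)
  assert (1 / 4 * (x + 1 / 2) ^ 3 / ((x + 1) * (x + y + 1) ^ 2) <= 1 / 4).
  { apply Rdiv_le_of_le_mul; [nra|].
    apply Rmult_le_compat_l; [lra|].
    replace ((x + 1 / 2) ^ 3) with ((x + 1 / 2) * (x + 1 / 2) ^ 2) by ring.
    apply Rmult_le_compat; [lra | apply pow_le; lra | lra | apply pow_incr; lra]. }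
  nra.
- intros y Hy.
  rewrite Rabs_pos_eq.
  2: { apply Rmult_le_pos; [lra|]. apply Rdiv_le_0_compat; [|nra]. lra. }
  replace (1 / 4 * (0 + 1 / 2) ^ 3 / ((0 + 1) * (0 + y + 1) ^ 2)) with
    (1 / (y + 1) * (1 / 32 / (y + 1))) by (field; lra).
  assert (Hi : 0 < 1 / (y + 1)) by (apply Rdiv_lt_0_compat; lra).
  assert (1 / 32 / (y + 1) <= 1 / 32) by (apply Rdiv_le_of_le_mul; lra).
  replace ((6 * 1 + 4 * y + 1) * (1 / (y + 1) * (1 / 32 / (y + 1)))) with
    (1 / (y + 1) * ((6 * 1 + 4 * y + 1) * (1 / 32 / (y + 1)))) by (field; lra).
  apply Rmult_le_compat_l; nra.
- apply is_lim_seq_ext with (2 := wallis).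
  intros k. simpl (0 + k)%nat. unfold w. simpl. fact_pos k. field. lra.
Qed.

(** Duplication formula: the even factors of (2n)! give 2^n n!, the odd ones 2^n (1/2)_n. *)
Lemma fact_double (n : nat) :
  INR (fact (2 * n)) = 4 ^ n * INR (fact n) * rising (1 / 2) n.
Proof.
induction n as [|n IH]; [simpl; ring|].
replace (2 * S n)%nat with (S (S (2 * n))) by lia.
rewrite !INR_fact_S, IH, rising_S, S_INR, mult_INR. simpl. field.
Qed.

(** The square of the sequence is the product of (4k+1) w_k^2, of the same expression at 2k, and of
    (4k+1)/(8k+1). Its limit is 8/PI^2, and the terms are nonnegative, so the square root may be
    taken. *)
Lemma wallis_double :
  is_lim_seq (fun k => (4 * INR k + 1) * (w k * w (2 * k))) (2 * sqrt 2 / PI).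
Proof.
assert (Hq : is_lim_seq (fun k => (4 * INR k + 1) / (8 * INR k + 1)) (1 / 2)).
{ assert (H0 : is_lim_seq (fun k => (4 * INR k + 1) / (8 * INR k + 1) - 1 / 2) 0).
  { apply is_lim_seq_le_const_mul_inv with 1. intros k. generalize (pos_INR k); intros Hk.
    replace ((4 * INR k + 1) / (8 * INR k + 1) - 1 / 2) with (/ (2 * (8 * INR k + 1)))
      by (field; lra).
    rewrite Rabs_pos_eq by (left; apply Rinv_0_lt_compat; lra).
    unfold Rdiv. rewrite Rmult_1_l. apply Rinv_le_contravar; lra. }
  apply is_lim_seq_ext with (fun k => ((4 * INR k + 1) / (8 * INR k + 1) - 1 / 2) + 1 / 2).
  { intros k. ring. }
  replace (Finite (1 / 2)) with (Finite (0 + 1 / 2)) by (f_equal; ring).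
  apply is_lim_seq_plus'; [exact H0 | apply is_lim_seq_const]. }
assert (Hd : is_lim_seq (fun k => (4 * INR (2 * k) + 1) * w (2 * k) ^ 2) (4 / PI)).
{ apply (is_lim_seq_subseq _ _ (fun k => (2 * k)%nat)) with (2 := wallis).
  apply eventually_subseq. intros n. lia. }
assert (Hs : is_lim_seq (fun k => ((4 * INR k + 1) * (w k * w (2 * k))) ^ 2)
  (4 / PI * (4 / PI) * (1 / 2))).
{ apply is_lim_seq_ext with (2 := is_lim_seq_mult' _ _ _ _
    (is_lim_seq_mult' _ _ _ _ wallis Hd) Hq).
  intros k. rewrite mult_INR. simpl (INR 2). generalize (pos_INR k); intros. field. lra. }
assert (HP := PI_RGT_0).
replace (2 * sqrt 2 / PI) with (sqrt (4 / PI * (4 / PI) * (1 / 2))).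
- apply is_lim_seq_ext with (fun k => sqrt (((4 * INR k + 1) * (w k * w (2 * k))) ^ 2)).
  + intros k. apply sqrt_pow2.
    generalize (pos_INR k) (w_pos k) (w_pos (2 * k)); intros.
    apply Rmult_le_pos; nra.
  + apply (is_lim_seq_continuous sqrt); [|exact Hs].
    apply continuity_pt_sqrt.
    assert (0 < 4 / PI) by (apply Rdiv_lt_0_compat; lra). nra.
- apply sqrt_lem_1.
  + assert (0 < 4 / PI) by (apply Rdiv_lt_0_compat; lra). nra.
  + apply Rmult_le_pos; [|left; now apply Rinv_0_lt_compat].
    generalize (sqrt_pos 2); lra.
  + replace (2 * sqrt 2 / PI * (2 * sqrt 2 / PI)) with (4 * (sqrt 2 * sqrt 2) / (PI * PI))
      by (field; lra).
    rewrite sqrt_sqrt by lra. field. lra.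
Qed.

(** The factor (1/2)_(n+2k) of H brings in w at 2k: at n = 0 the pair gives (4k+1) w_k w_(2k), and
    [wallis_double] yields the factor sqrt 2. *)
Lemma ramanujan_neg_512 :
  is_series (fun n => (6 * INR n + 1) * w n ^ 3 * (- 1 / 8) ^ n) (2 * sqrt 2 / PI).
Proof.
apply (is_series_ext_R (fun n => (6 * INR n + 4 * 0 + 1) *
  ((- 1 / 8) ^ n * (1 / 4) ^ 0 * rising (1 / 2) n ^ 2 * rising (1 / 2) (n + 2 * 0) /
    (INR (fact n) * INR (fact (n + 0)) ^ 2)))).
{ intros n. rewrite Nat.mul_0_r, Nat.add_0_r. unfold w. simpl ((1 / 4) ^ 0). field.
  apply INR_fact_neq_0. }
apply (wz_series_hypergeometric (fun n k => (- 1 / 8) ^ n * (1 / 4) ^ k * rising (1 / 2) n ^ 2 *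
    rising (1 / 2) (n + 2 * k) / (INR (fact n) * INR (fact (n + k)) ^ 2))
  (fun x y => 6 * x + 4 * y + 1) (fun x y => 4 * x)
  (fun x y => - (1 / 8 * ((x + 1 / 2) ^ 2 * (x + 2 * y + 1 / 2)) / ((x + 1) * (x + y + 1) ^ 2)))
  (fun x y => 1 / 4 * ((x + 2 * y + 1 / 2) * (x + 2 * y + 3 / 2)) / (x + y + 1) ^ 2) 1 1).
- intros n k. simpl (S n + k)%nat. simpl (S n + 2 * k)%nat.
  change (k + (k + 0))%nat with (2 * k)%nat.
  rewrite !INR_fact_S, !rising_S, !plus_INR, mult_INR.
  fact_pos n; fact_pos (n + k)%nat. generalize (pos_INR n) (pos_INR k); intros.
  simpl pow. simpl (INR 2). field. lra.
- intros n k. replace (n + 2 * S k)%nat with (S (S (n + 2 * k))) by lia.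
  rewrite Nat.add_succ_r, !INR_fact_S, !rising_S, S_INR, !plus_INR, mult_INR.
  fact_pos n; fact_pos (n + k)%nat. generalize (pos_INR n) (pos_INR k); intros.
  simpl (INR 2). simpl ((1 / 4) ^ S k). field. lra.
- intros y. ring.
- intros x y Hx Hy. field. lra.
- intros x y Hx Hy. rewrite Rabs_pos_eq; lra.
- intros x y Hx Hy.
  rewrite Rabs_mult, Rabs_Ropp, (Rabs_pos_eq (6 * (x + 1) + 4 * y + 1)) by lra.
  rewrite Rabs_pos_eq.
  2: { apply Rdiv_le_0_compat; [|nra].
       apply Rmult_le_pos; [lra|]. apply Rmult_le_pos; [apply pow_le|]; lra. }
  (* This follows from (x+1/2)^2 <= (x+1)(x+y+1) and x+2y+1/2 <= 2(x+y+1). As before, P at most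
     doubles for x >= 1. *)
  assert (1 / 8 * ((x + 1 / 2) ^ 2 * (x + 2 * y + 1 / 2)) / ((x + 1) * (x + y + 1) ^ 2) <= 1 / 4).
  { apply Rdiv_le_of_le_mul; [nra|].
    replace (1 / 4 * ((x + 1) * (x + y + 1) ^ 2)) with
      (1 / 8 * (((x + 1) * (x + y + 1)) * (2 * (x + y + 1)))) by field.
    apply Rmult_le_compat_l; [lra|].
    apply Rmult_le_compat; [apply pow_le; lra | lra | nra | lra]. }
  nra.
- intros y Hy.
  rewrite Rabs_mult, Rabs_Ropp, (Rabs_pos_eq (6 * 1 + 4 * y + 1)) by lra.
  rewrite Rabs_pos_eq by (apply Rdiv_le_0_compat; nra).
  replace ((6 * 1 + 4 * y + 1) * (1 / 8 * ((0 + 1 / 2) ^ 2 * (0 + 2 * y + 1 / 2)) /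
      ((0 + 1) * (0 + y + 1) ^ 2))) with
    (1 / (y + 1) * ((4 * y + 7) * (2 * y + 1 / 2) / 32 / (y + 1))) by (field; lra).
  apply Rmult_le_compat_l; [left; apply Rdiv_lt_0_compat; lra|].
  apply Rdiv_le_of_le_mul; nra.
- apply is_lim_seq_ext with (2 := wallis_double).
  intros k. simpl (0 + k)%nat. simpl (0 + 2 * k)%nat. change (k + (k + 0))%nat with (2 * k)%nat.
  rewrite (w_rising (2 * k)), fact_double. unfold w at 1. simpl rising. simpl (fact 0).
  fact_pos k. simpl (INR 1).
  (* The power 4^k from the duplication formula cancels the (1/4)^k of H. *)
  assert (H4 : 4 ^ k * (1 / 4) ^ k = 1).
  { rewrite <- Rpow_mult_distr. replace (4 * (1 / 4)) with 1 by field. apply pow1. }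
  simpl ((- 1 / 8) ^ 0).
  transitivity ((4 ^ k * (1 / 4) ^ k) *
    ((4 * INR k + 1) * (rising (1 / 2) k / INR (fact k) * w (2 * k)))).
  + rewrite H4. ring.
  + field. lra.
Qed.

(** The cubic P factors on both axes: P(n,0) = (42n+5)(2n+1)^2 and P(0,k) = (4k+5)(2k+1)^2. The
    squares absorb the extra factors of the odd factorial (2n+k+1)!, leaving the series at k = 0 and
    4 (4k+5) w_(k+1)^2 at n = 0. *)
Lemma ramanujan_4096 :
  is_series (fun n => (42 * INR n + 5) * w n ^ 3 * (1 / 64) ^ n) (16 / PI).
Proof.
set (P := fun x y => 5 + 24 * y + 36 * y ^ 2 + 16 * y ^ 3 + 62 * x + 160 * x * y
  + 104 * x * y ^ 2 + 188 * x ^ 2 + 224 * x ^ 2 * y + 168 * x ^ 3).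
apply (is_series_ext_R (fun n => P (INR n) 0 *
  ((1 / 4) ^ n * rising (1 / 2) n ^ 3 * rising (1 / 2) (n + 0) ^ 2 /
    (INR (fact n) * INR (fact (S (2 * n + 0))) ^ 2)))).
{ intros n. rewrite !Nat.add_0_r, INR_fact_S, fact_double, mult_INR. unfold w, P.
  simpl (INR 2).
  replace (1 / 64) with (1 / 4 * (1 / 4 * (1 / 4))) by field.
  rewrite !Rpow_mult_distr.
  assert (H4 : (1 / 4) ^ n = / 4 ^ n).
  { unfold Rdiv. rewrite Rmult_1_l. apply pow_inv. }
  rewrite H4. fact_pos n. assert (Hr : 0 < rising (1 / 2) n) by (apply rising_pos; lra).
  assert (Hp : 4 ^ n <> 0) by (apply pow_nonzero; lra).
  generalize (pos_INR n); intros. field. repeat split; lra. }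
apply (wz_series_hypergeometric (fun n k => (1 / 4) ^ n * rising (1 / 2) n ^ 3 *
    rising (1 / 2) (n + k) ^ 2 / (INR (fact n) * INR (fact (S (2 * n + k))) ^ 2)) P
  (fun x y => 32 * (x * (2 * x + y + 1) ^ 2))
  (fun x y => 1 / 4 * ((x + 1 / 2) * ((x + 1 / 2) ^ 2 * (x + y + 1 / 2) ^ 2)) /
     ((x + 1) * ((2 * x + y + 2) ^ 2 * (2 * x + y + 3) ^ 2)))
  (fun x y => (x + y + 1 / 2) ^ 2 / (2 * x + y + 2) ^ 2) 32 3); unfold P; clear P.
- intros n k. simpl (S n + k)%nat. replace (2 * S n + k)%nat with (S (S (2 * n + k))) by lia.
  rewrite !INR_fact_S, !rising_S, !S_INR, !plus_INR, mult_INR.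
  fact_pos n; fact_pos (2 * n + k)%nat. generalize (pos_INR n) (pos_INR k); intros.
  change ((1 / 4) ^ S n) with (1 / 4 * (1 / 4) ^ n). simpl (INR 2). field. repeat split; lra.
- intros n k. rewrite !Nat.add_succ_r, !INR_fact_S, !rising_S, !S_INR, !plus_INR, mult_INR.
  fact_pos n; fact_pos (2 * n + k)%nat. generalize (pos_INR n) (pos_INR k); intros.
  simpl (INR 2). field. repeat split; lra.
- intros y. ring.
- intros x y Hx Hy. field. repeat split; lra.
- intros x y Hx Hy.
  assert (0 <= y ^ 2) by (apply pow_le; lra). assert (0 <= y ^ 3) by (apply pow_le; lra).
  assert (0 <= x ^ 2) by (apply pow_le; lra). assert (0 <= x ^ 3) by (apply pow_le; lra).
  assert (0 <= x * y) by nra. assert (0 <= x * y ^ 2) by nra. assert (0 <= x ^ 2 * y) by nra.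
  split; [lra|].
  rewrite Rabs_pos_eq by (repeat apply Rmult_le_pos; try apply pow_le; lra).
  apply Rmult_le_compat_l; [lra|]. ring_simplify. lra.
- intros x y Hx Hy.
  (* The ratio 1/2 is reached as 1/16 for r times 8 for the growth of the cubic P. *)
  assert (Hr : 0 <= 1 / 4 * ((x + 1 / 2) * ((x + 1 / 2) ^ 2 * (x + y + 1 / 2) ^ 2)) /
     ((x + 1) * ((2 * x + y + 2) ^ 2 * (2 * x + y + 3) ^ 2)) <= 1 / 16).
  { split.
    - apply Rdiv_le_0_compat.
      + repeat apply Rmult_le_pos; try apply pow_le; lra.
      + repeat apply Rmult_lt_0_compat; lra.
    - apply Rdiv_le_of_le_mul.
      + repeat apply Rmult_lt_0_compat; lra.
      + replace (1 / 16 * ((x + 1) * ((2 * x + y + 2) ^ 2 * (2 * x + y + 3) ^ 2))) with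
          (1 / 4 * ((x + 1) * ((x + y / 2 + 1) ^ 2 * (2 * x + y + 3) ^ 2))) by field.
        apply Rmult_le_compat_l; [lra|].
        apply Rmult_le_compat; [lra | | lra |].
        { apply Rmult_le_pos; apply pow_le; lra. }
        apply Rmult_le_compat; try apply pow_le; try apply pow_incr; lra. }
  set (r := 1 / 4 * _ / _) in *. clearbody r.
  set (Q := 5 + _ + _ + _ + _ + _ + _ + _ + _ + _ : R).
  set (p := 5 + _ + _ + _ + _ + _ + _ + _ + _ + 168 * x ^ 3).
  assert (HQ : 0 <= Q <= 8 * p).
  { assert (0 <= y ^ 2) by (apply pow_le; lra). assert (0 <= y ^ 3) by (apply pow_le; lra).
    assert (Hz : 0 <= x - 1) by lra.
    (* Written in z = x - 1 and y, the polynomial 8p - Q has only nonnegative coefficients. *)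
    unfold Q, p. replace x with ((x - 1) + 1) by ring. set (z := x - 1) in *.
    assert (0 <= z ^ 2) by (apply pow_le; lra). assert (0 <= z ^ 3) by (apply pow_le; lra).
    assert (0 <= z * y) by nra. assert (0 <= z * y ^ 2) by nra. assert (0 <= z ^ 2 * y) by nra.
    split; ring_simplify; lra. }
  rewrite Rabs_pos_eq by (apply Rmult_le_pos; lra). nra.
- intros y Hy.
  assert (0 <= y ^ 2) by (apply pow_le; lra). assert (0 <= y ^ 3) by (apply pow_le; lra).
  rewrite Rabs_pos_eq.
  2: { apply Rmult_le_pos; [lra|]. apply Rdiv_le_0_compat.
      + repeat apply Rmult_le_pos; try apply pow_le; lra.
      + repeat apply Rmult_lt_0_compat; lra. }
  assert (Hi : 0 < / (y + 1)) by (apply Rinv_0_lt_compat; lra).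
  assert (Hr : 1 / 4 * ((0 + 1 / 2) * ((0 + 1 / 2) ^ 2 * (0 + y + 1 / 2) ^ 2)) /
     ((0 + 1) * ((2 * 0 + y + 2) ^ 2 * (2 * 0 + y + 3) ^ 2)) <= 1 / 32 * / (y + 1)).
  { apply Rdiv_le_of_le_mul.
    - repeat apply Rmult_lt_0_compat; lra.
    (* Since (y+3)^2 = (y+1)(y+5) + 4, division by y+1 leaves a factor that is at least 1. *)
    - replace (1 / 32 * / (y + 1) * ((0 + 1) * ((2 * 0 + y + 2) ^ 2 * (2 * 0 + y + 3) ^ 2)))
        with (1 / 32 * ((y + 2) ^ 2 * (y + 5 + 4 * / (y + 1)))) by (field; lra).
      replace (1 / 4 * ((0 + 1 / 2) * ((0 + 1 / 2) ^ 2 * (0 + y + 1 / 2) ^ 2)))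
        with (1 / 32 * ((y + 1 / 2) ^ 2 * 1)) by field.
      apply Rmult_le_compat_l; [lra|].
      apply Rmult_le_compat; [apply pow_le | | apply pow_incr |]; lra. }
  set (r := 1 / 4 * _ / _) in *. clearbody r.
  (* What remains is P(1,y) <= 96 P(0,y), true coefficient by coefficient; 96 = 32 d with d = 3. *)
  eapply Rle_trans; [apply Rmult_le_compat_l; [|exact Hr]; lra|].
  unfold Rdiv. rewrite <- Rmult_assoc, !(Rmult_comm _ (/ (y + 1))), !Rmult_assoc.
  apply Rmult_le_compat_l; lra.
- apply is_lim_seq_ext with (fun k => 4 * ((4 * INR (S k) + 1) * w (S k) ^ 2)).
  + intros k. rewrite w_S, S_INR. unfold w. simpl (2 * 0 + k)%nat. simpl (0 + k)%nat.
    rewrite INR_fact_S. simpl rising. simpl (fact 0). simpl (INR 1).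
    fact_pos k. generalize (pos_INR k); intros. field. lra.
  + replace (Finite (16 / PI)) with (Rbar_mult 4 (4 / PI))
      by (simpl; f_equal; field; apply PI_neq0).
    apply is_lim_seq_scal_l. apply (is_lim_seq_incr_1 (fun k => (4 * INR k + 1) * w k ^ 2)), wallis.
Qed.

(** * Central binomial coefficients in terms of [w] *)

(** Two absorption identities, passing through binom(2k+1, k). *)
Lemma binom_central_S (k : nat) :
  (INR k + 1) * binom (2 * S k) (S k) = 2 * (2 * INR k + 1) * binom (2 * k) k.
Proof.
unfold binom.
assert (H1 := binomial.mul_bin_diag (2 * S k) k).
assert (H2 := binomial.mul_bin_down (S (2 * k)) k).
apply (f_equal INR) in H1, H2.
(* The identity is restated, by conversion, with the Stdlib operations on nat. *)
change (@eq R (INR ((2 * S k) * binomial.binomial (Nat.pred (2 * S k)) k))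
  (INR (S k * binomial.binomial (2 * S k) (S k)))) in H1.
change (@eq R (INR (S (2 * k) * binomial.binomial (2 * k) k))
  (INR ((S (2 * k) - k) * binomial.binomial (S (2 * k)) k))) in H2.
replace (Nat.pred (2 * S k)) with (S (2 * k)) in H1 by lia.
replace (S (2 * k) - k)%nat with (S k) in H2 by lia.
rewrite (mult_INR (2 * S k)), (mult_INR (S k)), (mult_INR 2), (S_INR k) in H1.
rewrite (mult_INR (S (2 * k))), (mult_INR (S k)), (S_INR (2 * k)), (mult_INR 2), (S_INR k) in H2.
simpl (INR 2) in H1, H2.
rewrite <- H1, Rmult_assoc.
transitivity (2 * ((INR k + 1) * INR (binomial.binomial (S (2 * k)) k))); [ring|].
rewrite <- H2. ring.
Qed.

Lemma binom_central (k : nat) : binom (2 * k) k = 4 ^ k * w k.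
Proof.
induction k as [|k IH].
- unfold binom, w. simpl. field.
- generalize (pos_INR k); intros Hk.
  apply Rmult_eq_reg_l with (INR k + 1); [|lra].
  rewrite binom_central_S, IH, w_S. simpl pow. field. lra.
Qed.

(** The factor k makes this correct at k = 0 as well, where binom(0, 1) = 0. *)
Lemma binom_next_central (k : nat) :
  binom (2 * k) (k + 1) = INR k / (INR k + 1) * binom (2 * k) k.
Proof.
generalize (pos_INR k); intros Hk.
apply Rmult_eq_reg_l with (INR k + 1); [|lra].
replace (k + 1)%nat with (S k) by lia.
unfold binom. assert (H1 := binomial.mul_bin_left (2 * k) k).
apply (f_equal INR) in H1.
change (@eq R (INR (S k * binomial.binomial (2 * k) (S k)))
  (INR ((2 * k - k) * binomial.binomial (2 * k) k))) in H1.
replace (2 * k - k)%nat with k in H1 by lia.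
rewrite !mult_INR, S_INR in H1. rewrite H1. field. lra.
Qed.

(** * Vanishing of the telescoping terms at infinity *)

Lemma is_lim_seq_pow_mul_geom (m : nat) (q : R) :
  0 < Rabs q < 1 -> is_lim_seq (fun k => INR k ^ m * q ^ k) 0.
Proof.
intros Hq.
assert (Hq0 : q <> 0) by (intros E; rewrite E, Rabs_R0 in Hq; lra).
assert (Hlim : is_lim_seq (fun k => (1 + / (INR k + 1)) ^ m) 1).
{ induction m as [|m IH]; [apply is_lim_seq_const|].
  replace (Finite 1) with (Finite ((1 + 0) * 1)) by (f_equal; ring).
  apply (is_lim_seq_mult' (fun k => 1 + / (INR k + 1))); [|exact IH].
  apply is_lim_seq_plus'; [apply is_lim_seq_const|].
  apply is_lim_seq_le_const_mul_inv with 1. intros k. generalize (pos_INR k); intros.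
  rewrite Rabs_pos_eq; [lra|]. left. apply Rinv_0_lt_compat. lra. }
(* The ratio test needs nonzero terms, hence k+1 in place of k; the limit passes back by
   comparison. *)
assert (Hs : ex_series (fun k => (INR k + 1) ^ m * q ^ k)).
{ apply ex_series_Rabs, (ex_series_DAlembert _ (Rabs q)); [lra | |].
  - intros k. generalize (pos_INR k); intros.
    apply Rmult_integral_contrapositive_currified; apply pow_nonzero; lra.
  - apply is_lim_seq_ext with (fun k => Rabs q * (1 + / (INR k + 1)) ^ m).
    + intros k. generalize (pos_INR k); intros Hk.
      assert (0 < / (INR k + 1)) by (apply Rinv_0_lt_compat; lra).
      rewrite <- (Rabs_pos_eq ((1 + / (INR k + 1)) ^ m)) by (apply pow_le; lra).
      rewrite <- Rabs_mult. f_equal. rewrite S_INR.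
      replace (1 + / (INR k + 1)) with ((INR k + 1 + 1) / (INR k + 1)) by (field; lra).
      unfold Rdiv at 1. rewrite Rpow_mult_distr, pow_inv. simpl (q ^ S k).
      field. split; apply pow_nonzero; lra.
    + replace (Finite (Rabs q)) with (Rbar_mult (Rabs q) 1) by (simpl; f_equal; ring).
      now apply is_lim_seq_scal_l. }
apply ex_series_lim_0 in Hs.
apply is_lim_seq_abs in Hs. simpl in Hs. rewrite Rabs_R0 in Hs.
apply is_lim_seq_abs_0.
apply is_lim_seq_le_le with (fun _ => 0) (fun k => Rabs ((INR k + 1) ^ m * q ^ k)).
- intros k. split; [apply Rabs_pos|].
  rewrite !Rabs_mult. apply Rmult_le_compat_r; [apply Rabs_pos|].
  generalize (pos_INR k); intros.
  rewrite !Rabs_pos_eq by (apply pow_le; lra). apply pow_incr. lra.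
- apply is_lim_seq_const.
- exact Hs.
Qed.

Lemma w_le_1 (n : nat) : w n <= 1.
Proof.
induction n as [|n IH]; [unfold w; simpl; lra|].
rewrite w_S. generalize (pos_INR n) (w_pos n); intros.
apply Rdiv_le_of_le_mul; nra.
Qed.

Lemma is_lim_seq_pow_mul_w (m : nat) (q : R) :
  0 < Rabs q < 1 -> is_lim_seq (fun k => INR k ^ m * (w k ^ 3 * q ^ k)) 0.
Proof.
intros Hq.
assert (H := is_lim_seq_pow_mul_geom m q Hq).
apply is_lim_seq_abs in H. simpl in H. rewrite Rabs_R0 in H.
apply is_lim_seq_abs_0.
apply is_lim_seq_le_le with (fun _ => 0) (fun k => Rabs (INR k ^ m * q ^ k)).
- intros k. split; [apply Rabs_pos|].
  rewrite !Rabs_mult. apply Rmult_le_compat_l; [apply Rabs_pos|].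
  rewrite <- (Rmult_1_l (Rabs (q ^ k))) at 2.
  apply Rmult_le_compat_r; [apply Rabs_pos|].
  generalize (w_pos k) (w_le_1 k); intros.
  rewrite Rabs_pos_eq by (apply pow_le; lra).
  rewrite <- (pow1 3). apply pow_incr. lra.
- apply is_lim_seq_const.
- exact H.
Qed.

(** This covers both telescoping sequences T: m = 3 for the series with k^3 binom(2k,k)^3, m = 0 for
    those with binom(2k,k+1)^3. *)
Lemma is_lim_seq_quadratic_mul_w (a b c : R) (m : nat) (q : R) :
  0 < Rabs q < 1 ->
  is_lim_seq (fun k => (a + b * INR k + c * INR k ^ 2) * INR k ^ m * (w k ^ 3 * q ^ k)) 0.
Proof.
intros Hq.
assert (H : forall x i, is_lim_seq (fun k => x * (INR k ^ i * (w k ^ 3 * q ^ k))) (x * 0)).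
{ intros x i. apply (is_lim_seq_scal_l _ x 0). now apply is_lim_seq_pow_mul_w. }
assert (H3 := is_lim_seq_plus' _ _ _ _
  (is_lim_seq_plus' _ _ _ _ (H a m) (H b (S m))) (H c (S (S m)))).
replace (Finite (a * 0 + b * 0 + c * 0)) with (Finite 0) in H3 by (f_equal; ring).
apply is_lim_seq_ext with (2 := H3). intros k. simpl pow. ring.
Qed.

(** * Reduction to the Ramanujan series by telescoping *)

Lemma is_series_telescope (a b T : nat -> R) (alpha s : R) :
  is_series b s -> (forall k, a k = alpha * b k + (T (S k) - T k)) ->
  is_lim_seq T 0 -> is_series a (alpha * s - T 0%nat).
Proof.
intros Hb Ha HT.
assert (Hd : is_series (fun k => T (S k) - T k) (- T 0%nat)).
{ change (is_lim_seq (sum_n (fun k => T (S k) - T k)) (- T 0%nat)).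
  apply (is_lim_seq_ext (fun n => T (S n) - T 0%nat)).
  - induction n as [|n IH]; [now rewrite sum_O|].
    rewrite sum_Sn, <- IH. unfold plus; simpl. ring.
  - replace (Finite (- T 0%nat)) with (Finite (0 - T 0%nat)) by (f_equal; ring).
    apply is_lim_seq_minus'; [|apply is_lim_seq_const].
    now apply (is_lim_seq_incr_1 T). }
apply (is_series_ext_R (fun k => alpha * b k + (T (S k) - T k))).
{ intros k. now rewrite Ha. }
replace (alpha * s - T 0%nat) with (alpha * s + - T 0%nat) by ring.
apply (is_series_plus (fun k => alpha * b k)); [|exact Hd].
now apply (is_series_scal_l (K := R_AbsRing) (V := R_NormedModule)).
Qed.

Lemma binom_cube_div (m : R) (k : nat) :
  m <> 0 -> binom (2 * k) k ^ 3 / m ^ k = w k ^ 3 * (64 / m) ^ k.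
Proof.
intros Hm. rewrite binom_central. unfold Rdiv.
rewrite !Rpow_mult_distr, pow_inv.
replace 64 with (4 * (4 * 4)) by ring. rewrite !Rpow_mult_distr. ring.
Qed.

(* T(k) = (a + b k + c k^2) k^3 binom(2k,k)^3 / m^k. *)
Lemma series_cube_mul_binom (A B : R -> R) (m a b c alpha s t : R) :
  m <> 0 -> 0 < Rabs (64 / m) < 1 ->
  is_series (fun k => B (INR k) * w k ^ 3 * (64 / m) ^ k) s ->
  (forall x, A x * x ^ 3 = alpha * B x +
     ((a + b * (x + 1) + c * (x + 1) ^ 2) * (8 * (2 * x + 1) ^ 3 / m)
       - (a + b * x + c * x ^ 2) * x ^ 3)) ->
  t = alpha * s ->
  is_series (fun k => A (INR k) * INR k ^ 3 * binom (2 * k) k ^ 3 / m ^ k) t.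
Proof.
intros Hm Hq HB Hid ->.
set (T := fun k => (a + b * INR k + c * INR k ^ 2) * INR k ^ 3 * (w k ^ 3 * (64 / m) ^ k)).
(* The factor k^3 makes T(0) = 0. *)
replace (alpha * s) with (alpha * s - T 0%nat) by (unfold T; simpl; ring).
apply (is_series_telescope _ _ T _ _ HB); [|now apply is_lim_seq_quadratic_mul_w].
intros k. unfold Rdiv at 1. rewrite (Rmult_assoc _ (binom _ _ ^ 3)).
fold (binom (2 * k) k ^ 3 / m ^ k). rewrite binom_cube_div by exact Hm.
(* The quotient of w^3 q^k at k+1 and k is 8 (2k+1)^3 / (m (k+1)^3), with q = 64/m; its denominator
   cancels the cube (k+1)^3 in T(k+1). *)
rewrite Hid. unfold T. rewrite w_S, S_INR. generalize (pos_INR k); intros.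
simpl ((64 / m) ^ S k). field. lra.
Qed.

(* T(k) = (a + b k + c k^2) binom(2k,k)^3 / m^k, with T(0) = a. *)
Lemma series_binom_next (A B : R -> R) (m a b c alpha s t : R) :
  m <> 0 -> 0 < Rabs (64 / m) < 1 ->
  is_series (fun k => B (INR k) * w k ^ 3 * (64 / m) ^ k) s ->
  (forall x, A x * x ^ 3 = alpha * B x * (x + 1) ^ 3 +
     ((a + b * (x + 1) + c * (x + 1) ^ 2) * (8 * (2 * x + 1) ^ 3 / m)
       - (a + b * x + c * x ^ 2) * (x + 1) ^ 3)) ->
  t = alpha * s - a ->
  is_series (fun k => A (INR k) * binom (2 * k) (k + 1) ^ 3 / m ^ k) t.
Proof.
intros Hm Hq HB Hid ->.
set (T := fun k => (a + b * INR k + c * INR k ^ 2) * INR k ^ 0 * (w k ^ 3 * (64 / m) ^ k)).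
replace (alpha * s - a) with (alpha * s - T 0%nat) by (unfold T, w; simpl; field).
apply (is_series_telescope _ _ T _ _ HB); [|now apply is_lim_seq_quadratic_mul_w].
intros k. generalize (pos_INR k); intros Hk.
rewrite binom_next_central.
transitivity (A (INR k) * INR k ^ 3 / (INR k + 1) ^ 3 * (binom (2 * k) k ^ 3 / m ^ k)).
{ field. split; [now apply pow_nonzero | lra]. }
rewrite binom_cube_div by exact Hm.
(* The polynomial hypothesis is the termwise relation multiplied by (k+1)^3, which clears the
   denominators of both [binom_next_central] and [w_S]. *)
rewrite Hid. unfold T. rewrite w_S, S_INR.
simpl ((64 / m) ^ S k). field. repeat split; solve [exact Hm | lra].
Qed.

Theorem theorem1p1 :
  is_series (fun k : nat =>
      (6 * INR k ^ 2 - 19 * INR k + 6) * INR k ^ 3 * binom (2 * k) k ^ 3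
        / 256 ^ k)
    (- (1 / (12 * PI)))
  /\
  is_series (fun k : nat =>
      (13608 * INR k ^ 2 + 25050 * INR k + 10589) * binom (2 * k) (k + 1) ^ 3
        / 256 ^ k)
    (27296 - 84604 / PI)
  /\
  is_series (fun k : nat =>
      (18 * INR k ^ 2 - 29 * INR k + 16) * INR k ^ 3 * binom (2 * k) k ^ 3
        / (-512) ^ k)
    (sqrt 2 / (24 * PI))
  /\
  is_series (fun k : nat =>
      (83592 * INR k ^ 2 + 152922 * INR k + 64925) * binom (2 * k) (k + 1) ^ 3
        / (-512) ^ k)
    (625282 * (sqrt 2 / PI) - 281920)
  /\
  is_series (fun k : nat =>
      (198 * INR k ^ 2 - 425 * INR k + 210) * INR k ^ 3 * binom (2 * k) k ^ 3
        / 4096 ^ k)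
    (- (1 / (21 * PI)))
  /\
  is_series (fun k : nat =>
      (32473224 * INR k ^ 2 + 58012446 * INR k + 24235261)
        * binom (2 * k) (k + 1) ^ 3 / 4096 ^ k)
    (667628032 - 2097324016 / PI).
Proof.
assert (HP := PI_neq0).
assert (H256 : 0 < Rabs (64 / 256) < 1) by (rewrite Rabs_pos_eq; lra).
assert (H512 : 0 < Rabs (64 / -512) < 1) by (rewrite Rabs_left; lra).
assert (H4096 : 0 < Rabs (64 / 4096) < 1) by (rewrite Rabs_pos_eq; lra).
assert (B256 : is_series (fun k => (6 * INR k + 1) * w k ^ 3 * (64 / 256) ^ k) (4 / PI)).
{ replace (64 / 256) with (1 / 4) by field. exact ramanujan_256. }
assert (B512 : is_series (fun k => (6 * INR k + 1) * w k ^ 3 * (64 / -512) ^ k)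
  (2 * sqrt 2 / PI)).
{ replace (64 / -512) with (- 1 / 8) by field. exact ramanujan_neg_512. }
assert (B4096 : is_series (fun k => (42 * INR k + 5) * w k ^ 3 * (64 / 4096) ^ k) (16 / PI)).
{ replace (64 / 4096) with (1 / 64) by field. exact ramanujan_4096. }
split; [|split; [|split; [|split; [|split]]]].
(* In each case a, b, c and alpha solve the linear system obtained by comparing coefficients of x.
   For instance, x^5 gives c = A2 / (64/m - 1), where A2 is the leading coefficient of A. *)
- apply (series_cube_mul_binom (fun x => 6 * x ^ 2 - 19 * x + 6) (fun x => 6 * x + 1)
    256 (- 22 / 3) 16 (- 8) (- 1 / 48) (4 / PI));
    try assumption; try lra; intros; field; exact HP.
(* In the primed series -a is the integer part of the value, coming from T(0) = a, and alpha times s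
   is the part with 1/PI. *)
- apply (series_binom_next (fun x => 13608 * x ^ 2 + 25050 * x + 10589) (fun x => 6 * x + 1)
    256 (- 27296) (- 151200) (- 18144) (- 21151) (4 / PI));
    try assumption; try lra; intros; field; exact HP.
- apply (series_cube_mul_binom (fun x => 18 * x ^ 2 - 29 * x + 16) (fun x => 6 * x + 1)
    (-512) (- 44 / 3) 32 (- 16) (1 / 48) (2 * sqrt 2 / PI));
    try assumption; try lra; intros; field; exact HP.
- apply (series_binom_next (fun x => 83592 * x ^ 2 + 152922 * x + 64925) (fun x => 6 * x + 1)
    (-512) 281920 1758528 (- 74304) 312641 (2 * sqrt 2 / PI));
    try assumption; try lra; intros; field; exact HP.
- apply (series_cube_mul_binom (fun x => 198 * x ^ 2 - 425 * x + 210) (fun x => 42 * x + 5)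
    4096 (- 4448 / 21) (2944 / 7) (- 1408 / 7) (- 1 / 336) (16 / PI));
    try assumption; try lra; intros; field; exact HP.
- apply (series_binom_next (fun x => 32473224 * x ^ 2 + 58012446 * x + 24235261)
    (fun x => 42 * x + 5)
    4096 (- 667628032) (- 5553093120) (- 32988672) (- 131082751) (16 / PI));
    try assumption; try lra; intros; field; exact HP.
Qed.
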